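(* Let $k\ge 4$ be an integer and let $\alpha=\alpha_k$ be the unique root in the interval $(3,4)$ of the equation $a=\left(1+\frac{a-2}{k+1}\right)^{k+1}$. Then the online algorithm $\mathrm{UNI}_k$ described in the context is $\frac1\alpha$-competitive for maximizing a non-negative monotone submodular function under a $k$-uniform matroid constraint with free disposal. That is, for every ground set $\Omega$, every non-negative monotone submodular $f:2^\Omega\to\mathbb{R}_+$ and every finite sequence of distinct elements of $\Omega$, the final set $S$ held by the algorithm satisfies $f(S)\ge\frac1\alpha f(\mathsf{OPT})$.
   Context: Write $S+a:=S\cup\{a\}$, $S-a:=S\setminus\{a\}$, $f(a|S):=f(S+a)-f(S)$; $f$ is monotone if $S\subseteq T$ implies $f(S)\le f(T)$. Online problem with free disposal ($k$-uniform matroid): elements of $\Omega$ arrive one by one in a finite sequence whose length is unknown to the algorithm. The algorithm maintains a set $S$, initially empty, with $|S|\le k$. In each round, when $u$ arrives, it may remove elements from $S$ and may include $u$ in $S$, provided $|S|\le k$ afterwards; rejected or removed elements cannot be retrieved. $f$ is accessed by a value oracle. $\mathsf{OPT}$ is a subset of at most $k$ elements of the sequence maximizing $f$. Notation: $A$ is the set of all elements that have ever been added to $S$ (possibly removed since). For an element $u$ of the sequence, $A(u)$ is the set $A$ at the beginning of the round in which $u$ arrives. Put $w(u):=f(u|A(u))$ and, for the current set $S$ and an element $v$, $w_S(v):=f(v|A(v)\cap S)$. For a weight function $\omega$ and a set $T$, $\omega(T):=\sum_{v\in T}\omega(v)$. Algorithm $\mathrm{UNI}_k$: start with $S=A=\varnothing$.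 When $u$ arrives: if $w(u)>\frac1k\left(\alpha\cdot w_S(S)-w(A)\right)$, then (i) if $|S|=k$, let $u'\in\arg\min_{v\in S}w_S(v)$ and set $S\leftarrow S-u'+u$; if $|S|<k$, set $S\leftarrow S+u$; and (ii) set $A\leftarrow A+u$. Otherwise discard $u$. *)

(* Defs.v *)
From mathcomp Require Import all_boot all_order all_algebra.
From mathcomp Require Import finmap reals.

Set Implicit Arguments.
Unset Strict Implicit.
Unset Printing Implicit Defensive.

Import Order.TTheory GRing.Theory Num.Theory.

Local Open Scope fset_scope.
Local Open Scope ring_scope.

(* Only finitely many elements ever arrive, so set functions are given on the
   finite subsets of the ground set [Omega].  A function on all of 2^Omega
   restricts to one, and for finite [Omega] the two notions coincide. *)
Section SetFunctions.
Variables (R : realType) (Omega : choiceType).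
Implicit Types (f : {fset Omega} -> R) (S T : {fset Omega}) (u : Omega).

Definition nonneg f := forall S, 0 <= f S.

Definition monotone f := forall S T, S `<=` T -> f S <= f T.

Definition submodular f :=
  forall S T, f (S `|` T) + f (S `&` T) <= f S + f T.

Definition marginal f u S : R := f (u |` S) - f S.

Definition is_opt f (k : nat) (us : seq Omega) (O : {fset Omega}) :=
  [/\ {subset O <= us}, (#|` O| <= k)%N &
      forall T, {subset T <= us} -> (#|` T| <= k)%N -> f T <= f O].

End SetFunctions.

Definition is_alpha (R : realType) (k : nat) (a : R) :=
  3 < a < 4 /\ a = (1 + (a - 2) / k.+1%:R) ^+ k.+1.

Section Algorithm.
Variables (R : realType) (Omega : choiceType).

(* [past v] is A(v), the value of [added] at the beginning of the round in
   which [v] arrives; it is meaningful only for elements that have arrived. *)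
Record state := State {
  sol : {fset Omega};
  added : {fset Omega};
  past : Omega -> {fset Omega}
}.

Definition init_state : state := State fset0 fset0 (fun=> fset0).

Definition arrive (st : state) (u : Omega) : state :=
  State (sol st) (added st) (fun v => if v == u then added st else past st v).

Variables (f : {fset Omega} -> R) (k : nat) (alpha : R).

Definition w (st : state) (v : Omega) : R := marginal f v (past st v).

Definition w_sol (st : state) (v : Omega) : R :=
  marginal f v (past st v `&` sol st).

(* To be evaluated on a state in which the arrival of [u] is recorded. *)
Definition accepts (st : state) (u : Omega) : bool :=
  k%:R^-1 * (alpha * (\sum_(v <- sol st) w_sol st v) -
             \sum_(v <- added st) w st v) < w st u.

Definition is_argmin (st : state) (u' : Omega) :=
  u' \in sol st /\ forall v, v \in sol st -> w_sol st u' <= w_sol st v.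

(* A relation, because ties in the arg min may be broken arbitrarily. *)
Inductive uni_step (st0 : state) (u : Omega) : state -> Prop :=
| UniDiscard (st := arrive st0 u) of ~~ accepts st u :
    uni_step st0 u st
| UniAdd (st := arrive st0 u) of accepts st u & (#|` sol st| < k)%N :
    uni_step st0 u (State (u |` sol st) (u |` added st) (past st))
| UniSwap (st := arrive st0 u) (u' : Omega) of
    accepts st u & #|` sol st| = k & is_argmin st u' :
    uni_step st0 u
      (State (u |` (sol st `\ u')) (u |` added st) (past st)).

Inductive uni_run : seq Omega -> state -> Prop :=
| UniStart : uni_run [::] init_state
| UniRound us u st st' of uni_run us st & uni_step st u st' :
    uni_run (rcons us u) st'.

(* Every round respects the free-disposal rules. *)
Lemma uni_step_free_disposal st u st' : (0 < k)%N ->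
  (#|` sol st| <= k)%N -> uni_step st u st' ->
  sol st' `<=` u |` sol st /\ (#|` sol st'| <= k)%N.
Proof.
move=> k0 Sk [st1 _|st1 _ ltk|st1 u' _ eqk [u'S _]] /=.
- by split=> //; apply: fsubsetUr.
- split; first exact: fsubset_refl.
  by rewrite cardfsU1; case: (_ \notin _) => //; apply: ltnW.
- split; first by apply: fsetUS; apply: fsubD1set.
  rewrite cardfsU1; apply: leq_trans (_ : (1 + #|` sol st `\ u'| <= k)%N).
    by rewrite leq_add2r leq_b1.
  by move: Sk; rewrite (cardfsD1 u') u'S.
Qed.

(* No round gets stuck, so every sequence of arrivals has a run. *)
Lemma uni_step_total st u : (0 < k)%N ->
  (#|` sol st| <= k)%N -> exists st', uni_step st u st'.
Proof.
move=> k0 Sk; have [acc|rej] := boolP (accepts (arrive st u) u); last first.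
  by exists (arrive st u); apply: UniDiscard.
move: Sk; rewrite leq_eqVlt => /predU1P[eqk|ltk]; last first.
  by eexists; apply: UniAdd acc ltk.
have [v vS] : exists v, v \in sol st by apply/fset0Pn; rewrite -cardfs_gt0 eqk.
pose i0 := [` vS]; pose F (i : sol st) := w_sol (arrive st u) (val i).
case: (arg_minP F (erefl : xpredT i0)) => i _ min_i.
eexists; apply: UniSwap acc eqk (conj (valP i) _) => x xS.
exact: (min_i [` xS]).
Qed.

Lemma uni_run_total us : (0 < k)%N ->
  exists st, uni_run us st /\ (#|` sol st| <= k)%N.
Proof.
move=> k0; elim/last_ind: us => [|us u [st [run Sk]]].
  by exists init_state; split; [apply: UniStart | rewrite cardfs0].
have [st' step] := uni_step_total u k0 Sk; exists st'; split.
  exact: UniRound run step.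
by case: (uni_step_free_disposal k0 Sk step).
Qed.

End Algorithm.

(* Main.v *)
(** Let r = 1 + (alpha - 2)/(k+1), so that r^(k+1) = alpha and
    k (r - 1) = alpha - 1 - r; r is the double root of the characteristic
    equation of the extremal recurrence
    x_(t+1) = (1 + (alpha-1)/k) x_t - (alpha/k) x_(t-k).
    Write theta = alpha w_S(S) - w(A), so that u is accepted iff theta < k w(u).
    If S = {v_1, v_2, ...}, from the newest element to the oldest, then
    theta >= sum_i r^i w_S(v_i) throughout: deleting a lightest element from a
    full S lowers r times the right-hand side by at least r^(k+1) = alpha times
    its weight, the simultaneous growth of the other weights is covered because
    all coefficients are at most alpha, and the new element is paid for by
    k w(u) >= theta.  The same inequality bounds the lightest weight in terms of
    theta, which makes theta nondecreasing, so every discarded u satisfies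
    k w(u) <= theta for the final theta.  By submodularity
    f(OPT) <= f(A) + theta, and w(A), w_S(S) telescope to f(A) - f(empty)
    and f(S) - f(empty), so that f(OPT) <= alpha f(S). *)

Require Import Defs.
From mathcomp Require Import all_boot all_order all_algebra.
From mathcomp Require Import finmap reals.
From mathcomp Require Import ring lra.

Set Implicit Arguments.
Unset Strict Implicit.
Unset Printing Implicit Defensive.

Import Order.TTheory GRing.Theory Num.Theory.

Local Open Scope fset_scope.
Local Open Scope ring_scope.

(** * Existence and uniqueness of the root [alpha] *)

Section RootOfAlphaEquation.
Variable R : realType.
Implicit Types (x y a b : R) (n k : nat).

Lemma expr_inv_lt3 n : (0 < n)%N -> (1 + n%:R^-1) ^+ n < 3 :> R.
Proof.
case: n => // n _; set e : R := n.+1%:R^-1.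
have e0 : 0 < e by rewrite invr_gt0 ltr0n.
have en : n.+1%:R * e = 1 by rewrite mulfV // pnatr_eq0.
(* With [t = j * e] the bound is [1 + t + t^2 - t * e]; it propagates while [t <= 1] and equals
   [3 - e] at [t = 1]. *)
have quadratic j : (j <= n.+1)%N ->
    (1 + e) ^+ j <= 1 + j%:R * e + (j%:R * e) ^+ 2 - j%:R * e ^+ 2.
  elim: j => [|j IHj] jn; first by rewrite expr0; lra.
  have := IHj (ltnW jn); rewrite [(1 + e) ^+ j.+1]exprS -natr1.
  have j0 : 0 <= j%:R :> R by apply: ler0n.
  have je1 : j%:R * e <= 1.
    by rewrite -[leRHS]en ler_pM2r // ler_nat ltnW.
  move: (j%:R : R) j0 je1 => t t0 te1 le_j.
  have := ler_wpM2l (_ : 0 <= 1 + e) le_j; move=> /(_ ltac:(lra)).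
  move/le_trans; apply.
  have te0 : 0 <= t * e by apply: mulr_ge0 => //; lra.
  have : 0 <= e * ((t * e) * (1 - t * e)).
    by apply: mulr_ge0; [lra | apply: mulr_ge0 => //; lra].
  have : 0 <= t * e * e ^+ 2 by apply: mulr_ge0 => //; apply: sqr_ge0.
  by nra.
apply: le_lt_trans (quadratic _ (leqnn _)) _; rewrite en expr2 mulrA en.
by have := e0; lra.
Qed.

Lemma expr_2inv_gt4 n : (2 < n)%N -> 4 < (1 + 2 / n%:R) ^+ n :> R.
Proof.
move=> n2; set e : R := n%:R^-1.
have e0 : 0 < e by rewrite invr_gt0 ltr0n; apply: ltn_trans n2.
have en : n%:R * e = 1 by rewrite mulfV // pnatr_eq0; case: n n2 {e e0}.
have e3 : 3 * e <= 1.
  by rewrite -[leRHS]en ler_pM2r // ler_nat.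
(* The binomial expansion cut after its second-order term; at [j = n] it equals [5 - 2 * e]. *)
have quadratic j : 1 + j%:R * (2 * e) + 2 * (j%:R * e) * (j%:R * e - e)
    <= (1 + 2 * e) ^+ j.
  elim: j => [|j IHj]; first by rewrite expr0; lra.
  rewrite [X in _ <= X]exprS -natr1.
  have := ler_wpM2l (_ : 0 <= 1 + 2 * e) IHj; move=> /(_ ltac:(lra)).
  apply: le_trans.
  have : 0 <= e ^+ 2 * (4 * e * (j%:R * (j%:R - 1))).
    apply: mulr_ge0; first exact: sqr_ge0.
    apply: mulr_ge0; first lra.
    by case: j {IHj} => [|j]; rewrite ?mul0r // mulr_ge0 // subr_ge0 ler1n.
  by nra.
apply: lt_le_trans (quadratic n); rewrite mulrCA en.
by have := e0; lra.
Qed.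

(** Dividing the difference of powers by [y - x] leaves [n.+2] products of powers of [x] and [y],
    all at least 1 and the first one larger. *)
Lemma ltr_exprB x y n : 1 < x -> x < y ->
  n.+2%:R * (y - x) < y ^+ n.+2 - x ^+ n.+2.
Proof.
move=> x1 xy; have yx0 : 0 < y - x by lra.
rewrite subrXX mulrC ltr_pM2l //.
rewrite (_ : n.+2%:R = \sum_(i < n.+2) 1 :> R); last first.
  by rewrite sumr_const card_ord.
have y1 : 1 < y by lra.
rewrite big_ord_recl [X in _ < X]big_ord_recl ltr_leD //.
  by rewrite expr0 mulr1 exprn_egt1.
by apply: ler_sum => i _; rewrite mulr_ege1 // exprn_ege1 // ltW.
Qed.

Lemma is_alpha_uniq k a b : (0 < k)%N -> is_alpha k a -> is_alpha k b -> a = b.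
Proof.
move=> k0; wlog ab : a b / a < b.
  move=> hw ha hb; case: (ltgtP a b) => // ab; first exact: hw.
  by apply/esym; apply: hw.
case: k k0 => // k _ [/andP[a3 _] ea] [_ eb].
have n0 : 0 < k.+2%:R :> R by rewrite ltr0n.
(* Two roots would give bases whose powers differ by exactly [k.+2] times the difference of the
   bases. *)
have := @ltr_exprB (1 + (a - 2) / k.+2%:R) (1 + (b - 2) / k.+2%:R) k.
rewrite -ea -eb (_ : _ + _ / _ - _ = (b - a) / k.+2%:R); last by ring.
rewrite mulrCA mulfV ?gt_eqF // mulr1 ltxx => absurd.
suff: false by [].
apply: absurd; first by rewrite ltrDl divr_gt0 // subr_gt0; lra.
by rewrite ltrD2l ltr_pM2r ?invr_gt0 // ltrD2r.
Qed.

Lemma is_alpha_exists k : (1 < k)%N -> exists a, is_alpha k a.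
Proof.
move=> k1.
pose p : {poly R} := (1 + k.+1%:R^-1 *: ('X - 2%:P)) ^+ k.+1 - 'X.
have pE x : p.[x] = (1 + (x - 2) / k.+1%:R) ^+ k.+1 - x.
  by rewrite !hornerE [_^-1 * _]mulrC.
have p3 : p.[3] < 0.
  rewrite pE subr_lt0 (_ : 3 - 2 = 1 :> R); last by ring.
  by rewrite mul1r expr_inv_lt3.
have p4 : 0 < p.[4].
  rewrite pE subr_gt0 (_ : 4 - 2 = 2 :> R); last by ring.
  by rewrite expr_2inv_gt4.
have [||a /andP[a3 a4] /rootP pa] := @poly_ivt R p 3 4; first lra.
  by rewrite !ltW.
exists a; split; last by apply/esym/eqP; rewrite -subr_eq0 -pE pa.
rewrite !lt_neqAle a3 a4 !andbT; apply/andP; split.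
  by apply: contraTN p3 => /eqP->; rewrite pa ltxx.
by apply: contraTN p4 => /eqP<-; rewrite pa ltxx.
Qed.

Lemma is_alpha_base k a (r := 1 + (a - 2) / k.+1%:R) : is_alpha k a ->
  [/\ 1 < r, r ^+ k.+1 = a & k%:R * (r - 1) = a - 1 - r].
Proof.
move=> [/andP[a3 a4] ea]; have n0 : 0 < k.+1%:R :> R by rewrite ltr0n.
split; [by rewrite ltrDl divr_gt0 // subr_gt0; lra | by rewrite -ea |].
have : k.+1%:R * (r - 1) = a - 2.
  by rewrite /r addrC addKr mulrCA mulfV ?gt_eqF // mulr1.
by rewrite -natr1; lra.
Qed.

End RootOfAlphaEquation.

Section HornerSum.
Variables (R : realType) (Omega : eqType) (r : R).
Implicit Types (W : Omega -> R) (s : seq Omega) (m : R).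

(* The [i]-th element of [s], counted from 0, gets the coefficient r^(i+1). *)
Definition horner_sum W s : R := foldr (fun v z => r * (W v + z)) 0 s.

(** With [n = size s], [r ^+ n.+1 - r] is [r - 1] times the geometric sum [r + ... + r^n]. *)
Lemma horner_sum_ge W s m : 1 < r -> {in s, forall v, m <= W v} ->
  m * (r ^+ (size s).+1 - r) <= (r - 1) * horner_sum W s.
Proof.
move=> r1; have r0 := lt_trans ltr01 r1; elim: s => [|v s IHs] Ws /=.
  by rewrite expr1; lra.
rewrite -/(horner_sum W s).
have mv : m <= W v by apply: Ws; rewrite mem_head.
have /IHs IH : {in s, forall v, m <= W v}.
  by move=> x xs; apply: Ws; rewrite inE xs orbT.
have := ler_wpM2l (ltW r0) IH; rewrite [r ^+ (size s).+2]exprS.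
have : 0 <= (r - 1) * (r * (W v - m)).
  by apply: mulr_ge0; [lra | apply: mulr_ge0; [exact: ltW | lra]].
by nra.
Qed.

Lemma horner_sum_ge0 W s : 1 < r ->
  {in s, forall v, 0 <= W v} -> 0 <= horner_sum W s.
Proof.
by move=> r1 /(horner_sum_ge r1); rewrite mul0r pmulr_rge0 // subr_gt0.
Qed.

(* Removing a term lowers by one the exponent of each term after it; these are
   all at least [m], so in total at least the largest power is lost. *)
Lemma horner_sum_rem W s u m : 1 < r -> 0 <= m ->
  {in s, forall v, m <= W v} -> u \in s ->
  horner_sum W (rem u s) + r ^+ size s * m <= horner_sum W s.
Proof.
move=> r1 m0; have r0 := lt_trans ltr01 r1; elim: s => [|v s IHs] // Ws.
rewrite inE /= -/(horner_sum W s) eq_sym.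
have mv : m <= W v by apply: Ws; rewrite mem_head.
have Ws' : {in s, forall v, m <= W v}.
  by move=> x xs; apply: Ws; rewrite inE xs orbT.
case: (eqVneq v u) => [_ _|_ /= /(IHs Ws') IH]; last rewrite -/(horner_sum W _).
  (* Removing the head costs [r * W v] and, by the shift of exponents,
     [(r - 1) * horner_sum W s]. *)
  have := horner_sum_ge r1 Ws'.
  have : 0 <= r * (W v - m) by apply: mulr_ge0; [exact: ltW | lra].
  by nra.
have := ler_wpM2l (ltW r0) IH; rewrite exprS.
have : 0 <= r * (W v - m) by apply: mulr_ge0; [exact: ltW | lra].
have : 0 <= r * m by apply: mulr_ge0 => //; exact: ltW.
by nra.
Qed.

(** The largest coefficient, that of the last element, is [r ^+ size s]. *)
Lemma horner_sum_le W W' s : 1 < r -> {in s, forall v, W v <= W' v} ->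
  horner_sum W' s - horner_sum W s <=
    r ^+ size s * (\sum_(v <- s) W' v - \sum_(v <- s) W v).
Proof.
move=> r1; have r0 := lt_trans ltr01 r1; elim: s => [|v s IHs] Ws.
  by rewrite !big_nil /= !subrr mulr0.
have Wv : W v <= W' v by apply: Ws; rewrite mem_head.
have /IHs IH : {in s, forall v, W v <= W' v}.
  by move=> x xs; apply: Ws; rewrite inE xs orbT.
rewrite !big_cons /= -/(horner_sum W s) -/(horner_sum W' s) exprS.
have := ler_wpM2l (ltW r0) IH.
have : 0 <= r * ((r ^+ size s - 1) * (W' v - W v)).
  apply: mulr_ge0; first exact: ltW.
  by apply: mulr_ge0; rewrite subr_ge0 // exprn_ege1 // ltW.
by nra.
Qed.

End HornerSum.

(** * Marginals of a monotone submodular function *)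

Section Analysis.
Variables (R : realType) (Omega : choiceType) (f : {fset Omega} -> R).
Hypotheses (f_ge0 : nonneg f) (f_mono : monotone f) (f_sub : submodular f).
Implicit Types (S T : {fset Omega}) (u v : Omega).

Lemma marginal_ge0 v S : 0 <= marginal f v S.
Proof. by rewrite subr_ge0; apply/f_mono/fsubsetUr. Qed.

Lemma marginal_anti v S T : S `<=` T -> marginal f v T <= marginal f v S.
Proof.
move=> ST; have [vT|vT] := boolP (v \in T).
  by rewrite {1}/marginal (fsetUidPr _ _ _) ?fsub1set // subrr marginal_ge0.
have := f_sub (v |` S) T.
have -> : (v |` S) `|` T = v |` T by rewrite -fsetUA (fsetUidPr _ _ ST).
have -> : (v |` S) `&` T = S.
  rewrite fsetIUl (fsetIidPl ST) (_ : [fset v] `&` T = fset0) ?fset0U //.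
  by apply/eqP; rewrite fsetI_eq0 fdisjoint1X.
by rewrite /marginal; lra.
Qed.

Lemma sum_marginal_ge S (s : seq Omega) :
  f ([fset v in s] `|` S) <= f S + \sum_(v <- s) marginal f v S.
Proof.
elim: s => [|v s IHs].
  by rewrite big_nil addr0 fset_nil fset0U.
rewrite big_cons fset_cons -fsetUA.
have := marginal_anti v (fsubsetUr [fset v in s] S).
by rewrite {1}/marginal; lra.
Qed.

(** * The invariant of a run *)

Variables (k : nat) (alpha r : R).
Hypotheses (r1 : 1 < r) (r_alpha : r ^+ k.+1 = alpha).
Hypothesis kr : k%:R * (r - 1) = alpha - 1 - r.

Definition threshold (st : state Omega) : R :=
  alpha * (\sum_(v <- sol st) w_sol f st v) - \sum_(v <- added st) w f st v.

(** [telescope] ranges over all [T] so that it survives deletions from the solution; it is finally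
    used for [sol st] and [added st]. The list in [potential] supplies an order, newest first by
    construction, which [sol] forgets. *)
Record run_inv (D : seq Omega) (st : state Omega) : Prop := RunInv {
  sol_sub : sol st `<=` added st;
  added_sub : {subset added st <= D};
  past_sub : forall v, past st v `<=` added st;
  telescope : forall T,
    \sum_(v <- added st `&` T) marginal f v (past st v `&` T) =
      f (added st `&` T) - f fset0;
  rejected : forall v, v \in D -> v \notin added st ->
    k%:R * w f st v <= threshold st;
  potential : exists2 s, perm_eq s (sol st) &
    horner_sum r (w_sol f st) s <= threshold st
}.

Let k_gt0 : (0 < k)%N.
Proof.
(* For [k = 0] the hypotheses would give both [alpha = r] and [alpha = r + 1]. *)
have := r1; case: k kr r_alpha => // kr0 ra; suff: r = 0 by lra.
by move: kr0 ra; rewrite mul0r expr1; lra.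
Qed.

Lemma run_inv_init : run_inv [::] (init_state Omega).
Proof.
split => //=; try by move=> *; rewrite ?fsub0set.
- by move=> T; rewrite fset0I big_seq_fset0 subrr.
- by exists [::]; rewrite //= /threshold /= !big_seq_fset0 mulr0 subr0.
Qed.

(** As [u] is not in [added st], changing its [past] leaves all the sums intact. *)
Lemma run_inv_arrive D st u : u \notin D -> run_inv D st ->
  run_inv D (arrive st u).
Proof.
move=> uD [sS sA sP tel rej [s ps pot]].
have uA v : v \in added st -> (v == u) = false.
  by move=> vA; apply: contraNF uD => /eqP<-; apply: sA.
have thE : threshold (arrive st u) = threshold st.
  congr (_ * _ - _); apply: eq_big_seq => v vS; rewrite /w_sol /w /= uA //.
  exact: (fsubsetP sS).
split=> //=.
- by move=> v; case: eqP.
- move=> T; rewrite -tel; apply: eq_big_seq => v.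
  by rewrite inE => /andP[vA _]; rewrite uA.
- move=> v vD vA; rewrite thE /w /=; case: eqP => [vu|_]; last exact: rej.
  by rewrite -vu vD in uD.
- exists s => //; rewrite thE; apply: le_trans pot.
  rewrite le_eqVlt; apply/orP; left; apply/eqP.
  have: {in s, forall v, (v == u) = false}.
    by move=> v; rewrite (perm_mem ps) => /(fsubsetP sS)/uA.
  elim: s {ps} => //= v s IHs H; rewrite IHs; last first.
    by move=> x xs; apply: H; rewrite inE xs orbT.
  by rewrite {1}/w_sol /= H ?mem_head.
Qed.

(* [S0] is what remains of the solution after making room for [u]. *)
Lemma run_inv_accept D st u S0 s0 :
    run_inv D st -> u \notin D -> past st u = added st -> S0 `<=` sol st ->
    perm_eq s0 S0 -> (size s0 < k)%N ->
    threshold st <= k%:R * w f st u ->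
    alpha * (\sum_(v <- sol st) w_sol f st v - \sum_(v <- S0) w_sol f st v) +
      r * horner_sum r (w_sol f st) s0 <= r * threshold st ->
    alpha * (\sum_(v <- sol st) w_sol f st v - \sum_(v <- S0) w_sol f st v) <=
      (alpha - 1) * w f st u ->
  run_inv (rcons D u) (State (u |` S0) (u |` added st) (past st)).
Proof.
move=> [sS sA sP tel rej _] uD pu S0S ps0 sk th_w pot0 mono0.
have gt1r := r1; have krE := kr.
set st' := State _ _ _.
have uA : u \notin added st by apply: contra uD; apply: sA.
have uS0 : u \notin S0.
  by apply: contra uA => /(fsubsetP S0S); apply: (fsubsetP sS).
have uP v : u \notin past st v by apply: contra uA; apply: fsubsetP.
pose W := w_sol f st; pose W' := w_sol f st'.
have WW' : {in S0, forall v, W v <= W' v}.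
  move=> v vS0; apply: marginal_anti => /=.
  rewrite fsetIUr (_ : _ `&` [fset u] = fset0) ?fset0U ?fsetIS //.
  by apply/eqP; rewrite fsetI_eq0 fdisjointX1.
have Wu : w f st u <= W' u.
  by apply: marginal_anti; apply: fsubsetIl.
have := @horner_sum_le R Omega r W W' s0 r1.
rewrite !(perm_big _ ps0) /= => dW.
have {}dW : horner_sum r W' s0 - horner_sum r W s0 <=
   r ^+ size s0 * (\sum_(v <- S0) W' v - \sum_(v <- S0) W v).
  by apply: dW => v; rewrite (perm_mem ps0); apply: WW'.
set Sig' := \sum_(v <- S0) W' v in dW.
set Sig0 := \sum_(v <- S0) W v in dW.
set x := w f st u in th_w mono0 Wu.
have thE : threshold st' = alpha * (W' u + Sig') -
    (x + \sum_(v <- added st) w f st v).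
  by rewrite /threshold /= !big_fsetU1.
have Sig_le : Sig0 <= Sig'.
  by rewrite /Sig' /Sig0 [leLHS]big_seq [leRHS]big_seq; apply: ler_sum.
have x0 : 0 <= x by apply: marginal_ge0.
have alpha_ge : r + 1 <= alpha.
  have : 0 <= k%:R * (r - 1) by rewrite mulr_ge0 ?ler0n //; lra.
  by lra.
have th_mono : threshold st <= threshold st'.
  move: mono0; rewrite thE /threshold -/W -/Sig0.
  have : 0 <= alpha * (W' u - x) by apply: mulr_ge0; lra.
  have : 0 <= alpha * (Sig' - Sig0) by apply: mulr_ge0; lra.
  by lra.
split=> /=.
- by apply/fsetUS/(fsubset_trans S0S).
- move=> v; rewrite mem_rcons !inE => /orP[->//|/sA->]; apply: orbT.
- by move=> v; apply: fsubset_trans (fsubsetUr _ _).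
- move=> T; have [uT|uT] := boolP (u \in T).
    have -> : (u |` added st) `&` T = u |` (added st `&` T).
      by rewrite fsetIUl (fsetIidPl _) // fsub1set.
    rewrite big_fsetU1 /=; last by rewrite inE (negPf uA).
    by rewrite tel pu /marginal; lra.
  have -> : (u |` added st) `&` T = added st `&` T.
    rewrite fsetIUl (_ : [fset u] `&` T = fset0) ?fset0U //.
    by apply/eqP; rewrite fsetI_eq0 fdisjoint1X.
  exact: tel.
- move=> v; rewrite mem_rcons !inE negb_or => /orP[->//|vD] /andP[_ vA].
  exact: le_trans (rej v vD vA) th_mono.
- exists (u :: s0).
    rewrite uniq_perm /= ?fset_uniq //.
      by rewrite (perm_mem ps0) uS0 (perm_uniq ps0) fset_uniq.
    by move=> v; rewrite !inE (perm_mem ps0).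
  rewrite thE /= -/W'.
  (* Putting [u] in front adds a factor [r] to every old coefficient; all stay at most
     [r^k <= alpha]. *)
  have rk : r * r ^+ size s0 <= alpha.
    by rewrite -exprS -r_alpha ler_weXn2l ?(ltW r1) // ltnS ltnW.
  have raise : r * (horner_sum r W' s0 - horner_sum r W s0) <=
      alpha * (Sig' - Sig0).
    apply: le_trans (ler_wpM2r _ rk); last by lra.
    by rewrite -mulrA; apply: ler_wpM2l => //; lra.
  have : 0 <= (alpha - r) * (W' u - x) by apply: mulr_ge0; lra.
  (* Scaling the potential by [r] costs [(r - 1) * threshold st]; by acceptance and [kr], the weight
     of [u] pays for it. *)
  have gain : (r - 1) * threshold st <= (alpha - 1 - r) * x.
    by rewrite -krE mulrAC [leRHS]mulrC ler_wpM2l //; lra.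
  have : threshold st = alpha * \sum_(v <- sol st) W v -
      \sum_(v <- added st) w f st v by [].
  by move: pot0; rewrite -/W -/Sig0; lra.
Qed.

Lemma threshold_accepts st u :
  accepts f k alpha st u = (threshold st < k%:R * w f st u).
Proof. by rewrite /accepts ltr_pdivrMl ?ltr0n. Qed.

(* [m] is at most the fraction 1 / (r + ... + r^k) of the potential, and [x] is
   at least a k-th of it. *)
Lemma min_weight_le (W : Omega -> R) (s : seq Omega) (m x : R) :
    size s = k -> 0 <= m -> {in s, forall v, m <= W v} ->
    horner_sum r W s <= k%:R * x ->
  alpha * m <= (alpha - 1) * x.
Proof.
move=> sk m0 Ws pot; have gt1r := r1; have krE := kr.
have := horner_sum_ge gt1r Ws; rewrite sk r_alpha => min_pot.
have kr_gt0 : 0 < k%:R * (r - 1) by rewrite mulr_gt0 ?ltr0n // subr_gt0.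
have gain : m * (alpha - r) <= (alpha - 1 - r) * x.
  apply: le_trans min_pot _; rewrite -krE mulrAC [leRHS]mulrC.
  by rewrite ler_wpM2l //; lra.
rewrite -(ler_pM2l kr_gt0) krE.
have : 0 <= (alpha - 1) * ((alpha - 1 - r) * x - m * (alpha - r)).
  by apply: mulr_ge0; lra.
(* The slack is [r * m], since [(alpha - 1) * (alpha - r) = alpha * (alpha - 1 - r) + r]. *)
have : 0 <= r * m by apply: mulr_ge0; lra.
by nra.
Qed.

Lemma run_inv_step D st u st' : u \notin D -> run_inv D st ->
  uni_step f k alpha st u st' -> run_inv (rcons D u) st'.
Proof.
move=> uD /(run_inv_arrive uD) + step.
have : past (arrive st u) u = added (arrive st u) by rewrite /= eqxx.
case: step => {st'} [st1|st1|st1 u'].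
- rewrite threshold_accepts -leNgt -/st1 => rej pu [sS sA sP tel old pot].
  split=> // v; first by move=> /sA; rewrite mem_rcons inE orbC => ->.
  by rewrite mem_rcons inE => /orP[/eqP-> _ //|]; apply: old.
- rewrite threshold_accepts -/st1 => acc lt_k pu inv.
  have [_ _ _ _ _ [s ps pot]] := inv.
  apply: (run_inv_accept inv uD pu _ ps) => //.
  + by rewrite (perm_size ps).
  + exact: ltW.
  + by rewrite subrr mulr0 add0r ler_pM2l // (lt_trans ltr01).
  + rewrite subrr mulr0 mulr_ge0 ?marginal_ge0 //.
    have : 0 <= k%:R * (r - 1) by rewrite mulr_ge0 ?ler0n // subr_ge0 ltW.
    by have := r1; have := kr; lra.
- rewrite threshold_accepts -/st1 => acc sz_k [u'S u'min] pu inv.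
  have [_ _ _ _ _ [s ps pot]] := inv.
  have sz_s : size s = k by rewrite (perm_size ps).
  have u's : u' \in s by rewrite (perm_mem ps).
  have s_min : {in s, forall v, w_sol f st1 u' <= w_sol f st1 v}.
    by move=> v; rewrite (perm_mem ps); apply: u'min.
  have m0 : 0 <= w_sol f st1 u' by apply: marginal_ge0.
  have rem_eq : \sum_(v <- sol st1) w_sol f st1 v -
      \sum_(v <- sol st1 `\ u') w_sol f st1 v = w_sol f st1 u'.
    by rewrite (big_fsetD1 u') //= addrK.
  have us : uniq s by rewrite (perm_uniq ps) fset_uniq.
  apply: (run_inv_accept (s0 := rem u' s) inv uD pu).
  + exact: fsubD1set.
  + apply: uniq_perm; rewrite ?rem_uniq ?fset_uniq // => v.
    by rewrite mem_rem_uniq // !inE (perm_mem ps).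
  + by rewrite size_rem // sz_s prednK.
  + exact: ltW.
  (* Taking one factor [r] out of [alpha = r^(k+1)] leaves the loss [r^k] of [horner_sum_rem], as
     [size s = k]. *)
  + rewrite rem_eq -r_alpha exprS -mulrA -mulrDr ler_pM2l ?(lt_trans ltr01) //.
    apply: le_trans pot; rewrite addrC -sz_s.
    exact: horner_sum_rem.
  + rewrite rem_eq; apply: min_weight_le sz_s m0 s_min _.
    exact: le_trans pot (ltW acc).
Qed.

Lemma run_invP us st : uniq us -> uni_run f k alpha us st -> run_inv us st.
Proof.
move=> + run; elim: run => [_|D u st0 st' _ IH step].
  exact: run_inv_init.
rewrite rcons_uniq => /andP[uD /IH inv]; exact: run_inv_step inv step.
Qed.

(** * Comparison with the optimum *)

Lemma run_inv_opt us st O : 1 <= alpha -> run_inv us st ->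
  {subset O <= us} -> (#|` O| <= k)%N -> f O <= alpha * f (sol st).
Proof.
move=> alpha1 [sS sA sP tel rej [s ps pot]] Ous cO.
set th := threshold st in rej pot.
have th0 : 0 <= th.
  by apply: le_trans pot; apply: horner_sum_ge0 => // v _; apply: marginal_ge0.
have k0 : 0 < k%:R :> R by rewrite ltr0n.
(* Elements of [O] never added were rejected: at most [k] of them, each of marginal at most
   [th / k], which only shrinks as the added set grows. *)
have gap : \sum_(v <- O `\` added st) marginal f v (added st) <= th.
  apply: le_trans (_ : \sum_(v <- O `\` added st) k%:R^-1 * th <= _).
    rewrite [leLHS]big_seq [leRHS]big_seq; apply: ler_sum => v.
    rewrite inE => /andP[vA vO].
    rewrite ler_pdivlMl //; apply: le_trans (rej v (Ous v vO) vA).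
    by rewrite ler_pM2l //; apply: marginal_anti.
  rewrite big_const_seq count_predT iter_addr_0 -[_ *+ _]mulr_natl mulrA.
  rewrite ler_piMl // ler_pdivrMr // mul1r ler_nat.
  exact: leq_trans (fsubset_leq_card (fsubsetDl _ _)) cO.
have fO : f O <= f (added st) + th.
  apply: le_trans (_ : f (O `|` added st) <= _); first exact/f_mono/fsubsetUl.
  have := sum_marginal_ge (added st) (O `\` added st).
  rewrite (_ : [fset v in _] = O `\` added st); last first.
    by apply/fsetP => v; rewrite !inE.
  have -> : (O `\` added st) `|` added st = O `|` added st.
    apply/fsetP => v; rewrite !inE.
    by case: (v \in added st); rewrite ?orbT ?orbF.
  by lra.
have fS : \sum_(v <- sol st) w_sol f st v = f (sol st) - f fset0.
  by have := tel (sol st); rewrite (fsetIidPr sS).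
have fA : \sum_(v <- added st) w f st v = f (added st) - f fset0.
  have := tel (added st); rewrite fsetIid => <-.
  by apply: eq_bigr => v _; rewrite (fsetIidPl (sP v)).
(* After telescoping, [f (added st)] cancels and the bound reads [alpha * f (sol st) - (alpha - 1) *
   f fset0]. *)
have : 0 <= (alpha - 1) * f fset0 by rewrite mulr_ge0 ?subr_ge0.
by move: fO; rewrite /th /threshold fS fA; lra.
Qed.

End Analysis.

Theorem theorem3p1 (R : realType) (k : nat) (hk : (4 <= k)%N) :
  (exists! alpha : R, is_alpha k alpha) /\
  forall alpha : R, is_alpha k alpha ->
  forall (Omega : choiceType) (f : {fset Omega} -> R),
    nonneg f -> monotone f -> submodular f ->
  forall us : seq Omega, uniq us ->
  forall st : state Omega, uni_run f k alpha us st ->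
  forall OPT : {fset Omega}, is_opt f k us OPT ->
    alpha^-1 * f OPT <= f (sol st).
Proof.
split.
  have [a ha] : exists a : R, is_alpha k a.
    by apply: is_alpha_exists; apply: leq_trans hk.
  exists a; split=> // b; apply: is_alpha_uniq ha.
  exact: leq_trans hk.
move=> alpha ha Omega f f0 fm fs us uus st run OPT [Ous cO _].
have [r1 ra kr] := is_alpha_base ha.
have [/andP[a3 _] _] := ha.
rewrite ler_pdivrMl; last by lra.
have inv := run_invP fm fs r1 ra kr uus run.
by apply: (run_inv_opt f0 fm fs r1 ra kr _ inv Ous cO); lra.
Qed.
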